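(* Let $0<\delta\leq 1\leq T$, let $\varepsilon>0$ be the desired precision, and let $\beta\in(1,2)$. Choose positive integers $n_o=O(\log\frac{1}{\varepsilon})$, $n_s=O(\log\frac{1}{\varepsilon})$, $n_l=O(\log\frac{1}{\varepsilon}+\log\frac{1}{\delta})$, a nonnegative integer $N=O(\log\log\frac{1}{\varepsilon}+\log\frac{1}{\delta})$, and a negative integer $M$ with $|M|=O(\log T)$. Let $s_{o,1},\dots,s_{o,n_o}$ and $w_{o,1},\dots,w_{o,n_o}$ be the nodes and weights of the $n_o$-point Gauss–Jacobi quadrature on $[0,2^M]$ with weight function $s^{\beta-1}$; for $j=M,\dots,-1$ let $s_{j,1},\dots,s_{j,n_s}$ and $w_{j,1},\dots,w_{j,n_s}$ be the nodes and weights of the $n_s$-point Gauss–Legendre quadrature on $[2^j,2^{j+1}]$; and for $j=0,\dots,N$ let $s_{j,1},\dots,s_{j,n_l}$ and $w_{j,1},\dots,w_{j,n_l}$ be the nodes and weights of the $n_l$-point Gauss–Legendre quadrature on $[2^j,2^{j+1}]$. Then (with the implied constants in the $O$-bounds suitably chosen) for all $t\in[\delta,T]$, $$\left|\frac{\Gamma(\beta)}{t^\beta}-\left(\sum_{k=1}^{n_o}e^{-s_{o,k}t}w_{o,k}+\sum_{j=M}^{-1}\sum_{k=1}^{n_s}e^{-s_{j,k}t}s_{j,k}^{\beta-1}w_{j,k}+\sum_{j=0}^{N}\sum_{k=1}^{n_l}e^{-s_{j,k}t}s_{j,k}^{\beta-1}w_{j,k}\right)\right|\leq\varepsilon.$$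
   Context: $\Gamma$ is the Euler Gamma function. The $n$-point Gauss–Legendre quadrature on $[a,b]$ is the rule $\int_a^b\phi(s)\,ds\approx\sum_k w_k\phi(s_k)$ exact for polynomials of degree $\leq 2n-1$. The $n$-point Gauss–Jacobi quadrature on $[0,a]$ with weight $s^{\beta-1}$ is the rule $\int_0^a\phi(s)s^{\beta-1}\,ds\approx\sum_k w_k\phi(s_k)$ exact for polynomials $\phi$ of degree $\leq 2n-1$. *)

(* Defs.v *)
From HB Require Import structures.
From mathcomp Require Import all_boot all_order all_algebra.
From mathcomp Require Import all_classical all_reals all_analysis.
Set Implicit Arguments. Unset Strict Implicit. Unset Printing Implicit Defensive.
Import Order.TTheory GRing.Theory Num.Theory.
Local Open Scope classical_set_scope.
Local Open Scope ring_scope.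

Definition Gamma_fn (R : realType) (b : R) : R :=
  fine (\int[@lebesgue_measure R]_(x in `[0%R, +oo[) (x `^ (b - 1) * expR (- x))%:E)%E.

Definition is_gauss_rule (R : realType) (wt : R -> R) (a b : R) (n : nat)
    (s w : 'I_n -> R) : Prop :=
  forall p : {poly R}, (size p <= 2 * n)%N ->
    (\int[@lebesgue_measure R]_(x in `[a, b]) (p.[x] * wt x)%:E)%E
    = (\sum_(k < n) w k * p.[s k])%:E.

(* Main.v *)
(**
With [alpha = beta - 1], the substitution [x = s t] gives
[Gamma(beta) / t^beta = int_0^oo e^(-s t) s^alpha ds], which is split at the
dyadic points [2^M, ..., 2^(N+1)].

Exactness in degree [2n - 1] forces the weights of a Gauss rule to be
nonnegative and its nodes to lie in the interval. Hence the error of the rule is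
at most twice the mass of the weight times the distance, in the uniform norm,
from the integrand to the polynomials of degree at most [2n - 1].

On [[a, 2a]], with [s = a u], the factors [e^(-a t u)] and [u^alpha] are each
approximated by their Taylor polynomials of degree less than [n] at the midpoint
[u = 3/2]. The Lagrange remainders are at most [2^-n] and [2 * 2^-n], uniformly
in [t], because [lam^n e^(-lam) <= n!] and [|alpha (alpha - 1) ... (alpha - n + 1)|
<= n!]. The errors of the panels with [a < 1] therefore add up to [O(2^-n)]
whatever [M] is, those with [a >= 1] to [O(4^N 2^-n)], and the tail beyond
[2^(N+1)] is [O(delta^-2 e^(-2^N delta))].
*)

Require Import Defs.
From HB Require Import structures.
From mathcomp Require Import all_boot all_order all_algebra.
From mathcomp Require Import all_classical all_reals all_analysis.
From mathcomp Require Import measurable_realfun ring lra zify.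
Set Implicit Arguments. Unset Strict Implicit. Unset Printing Implicit Defensive.
Import Order.TTheory GRing.Theory Num.Theory.
Import numFieldNormedType.Exports.
Local Open Scope classical_set_scope.
Local Open Scope ring_scope.

Local Notation mu R := (@lebesgue_measure R).

(** * Taylor approximation *)

(** By the mean value theorem, the difference between the monomial and [F] has a nonnegative
    increment over [[0, x]]. The bound is kept one-sided so that it applies to both [F] and
    [- F]. *)
Lemma le_monomial_of_derive_le (R : realType) (F dF : R -> R) (r K : R)
    (n : nat) :
  (forall x : R, 0 <= x <= r -> is_derive x 1 F (dF x)) ->
  (forall x : R, 0 <= x <= r -> dF x <= K * x ^+ n) -> F 0 = 0 ->
  forall x : R, 0 <= x <= r -> F x <= K * x ^+ n.+1 / n.+1%:R.
Proof.
move=> dFP dFle F0 x /andP[x0 xr].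
pose p : {poly R} := (K / n.+1%:R) *: 'X ^+ n.+1.
pose H := horner p - F.
have dH (y : R) : 0 <= y <= r -> is_derive y 1 H (K * y ^+ n - dF y).
  move=> yr; have dFy := dFP _ yr.
  rewrite /H; apply: is_derive_eq.
  rewrite /p derivZ derivXn/= hornerZ hornerMn hornerXn -mulr_natr.
  by congr (_ - _); field; rewrite addrC natr1 pnatr_eq0.
have [y yx /= Hy] : exists2 c, c \in `[0, x]%R &
    H x - H 0 = (K * c ^+ n - dF c) * (x - 0).
  apply: MVT_segment => //.
    by move=> y; rewrite in_itv/= => /andP[? ?]; apply: dH; lra.
  apply: derivable_within_continuous => y; rewrite in_itv/= => /andP[? ?].
  by apply: ex_derive; apply: dH; lra.
have : 0 <= H x - H 0.
  rewrite Hy subr0 mulr_ge0// subr_ge0 dFle//.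
  by move: yx; rewrite in_itv/=; lra.
rewrite /H /p !fctE !hornerE F0 expr0n/= mulr0 !subr0 subr_ge0.
by rewrite mulrAC.
Qed.

Lemma norm_le_monomial_of_derive (R : realType) (F dF : R -> R) (r K : R)
    (n : nat) :
  (forall x : R, `|x| <= r -> is_derive x 1 F (dF x)) ->
  (forall x : R, `|x| <= r -> `|dF x| <= K * `|x| ^+ n) -> F 0 = 0 ->
  forall x : R, `|x| <= r -> `|F x| <= K * `|x| ^+ n.+1 / n.+1%:R.
Proof.
have half (G dG : R -> R) :
    (forall x : R, 0 <= x <= r -> is_derive x 1 G (dG x)) ->
    (forall x : R, 0 <= x <= r -> `|dG x| <= K * x ^+ n) -> G 0 = 0 ->
    forall x : R, 0 <= x <= r -> `|G x| <= K * x ^+ n.+1 / n.+1%:R.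
  move=> dGP dGle G0 x xr; rewrite ler_norml lerNl; apply/andP; split.
    apply: (@le_monomial_of_derive_le _ (- G) (fun x => - dG x) r) => //.
    - by move=> y yr; have := dGP _ yr => ?; exact: is_deriveN.
    - by move=> y yr; rewrite (le_trans _ (dGle _ yr))// -normrN ler_norm.
    - by rewrite fctE G0 oppr0.
  apply: (@le_monomial_of_derive_le _ G dG r) => // y yr.
  by rewrite (le_trans _ (dGle _ yr))// ler_norm.
move=> dFP dFle F0 x xr.
have nr (y : R) : 0 <= y <= r -> `|y| = y /\ `|y| <= r.
  by move=> /andP[y0 yr]; rewrite ger0_norm.
have [x0|x0] := leP 0 x.
  rewrite (ger0_norm x0) in xr *; apply: (half F dF) => //; last exact/andP.
    by move=> y /nr[_ yr]; exact: dFP.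
  by move=> y /nr[yE yr]; rewrite -{2}yE dFle.
(* Negative arguments are reduced to positive ones by the reflection [F \o -%R]. *)
rewrite (ltr0_norm x0) in xr *.
rewrite -{1}[x]opprK -[F (- - x)]/((F \o -%R) (- x)).
apply: (half (F \o -%R) (fun y => - dF (- y))) => //.
- move=> y /nr[_]; rewrite -normrN => yr; have dFy := dFP _ yr.
  rewrite -[- dF _]mulrN1; exact: is_derive1_comp.
- by move=> y /nr[yE]; rewrite -normrN => /dFle; rewrite !normrN yE.
- by rewrite /= oppr0.
- by rewrite xr oppr_ge0 ltW.
Qed.

(** [g k] plays the part of the [k]-th derivative of [g 0], so the expansion is at the origin. With
    the derivatives given as a family, differentiating the polynomial amounts to shifting the
    family. *)
Definition taylor_poly (R : realType) (g : nat -> R -> R) (n : nat) : {poly R} :=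
  \sum_(k < n) (g k 0 / k`!%:R) *: 'X^k.

Lemma size_taylor_poly (R : realType) (g : nat -> R -> R) (n : nat) :
  (size (taylor_poly g n) <= n)%N.
Proof.
apply: (leq_trans (size_sum _ _ _)); apply/bigmax_leqP => k _.
by rewrite (leq_trans (size_scale_leq _ _))// size_polyXn.
Qed.

Lemma deriv_taylor_poly (R : realType) (g : nat -> R -> R) (n : nat) :
  (taylor_poly g n.+1)^`() = taylor_poly (fun k => g k.+1) n.
Proof.
rewrite /taylor_poly raddf_sum big_ord_recl/= derivZ expr0 derivC.
rewrite scaler0 add0r.
apply: eq_bigr => k _; rewrite /bump/= add1n derivZ derivXn/=.
rewrite -scalerMnr scalerMnl factS natrM invfM -mulr_natr; congr (_ *: _).
by rewrite -mulrA mulrAC mulVf ?mul1r// pnatr_eq0.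
Qed.

Lemma horner0_taylor_poly (R : realType) (g : nat -> R -> R) (n : nat) :
  (taylor_poly g n.+1).[0] = g 0%N 0.
Proof.
rewrite /taylor_poly big_ord_recl/= !hornerE/= horner_sum big1 ?addr0.
  by rewrite fact0 divr1.
by move=> k _; rewrite !hornerE/= expr0n/= mulr0.
Qed.

(** Induction on the order: the derivative of the remainder is the remainder of the shifted family,
    one order lower, and integrating its bound gains the factor [|y| / (n + 1)]. *)
Lemma taylor_bound (R : realType) (g : nat -> R -> R) (n : nat) (r B : R) :
  (forall k (y : R), (k < n)%N -> `|y| <= r -> is_derive y 1 (g k) (g k.+1 y)) ->
  (forall y : R, `|y| <= r -> `|g n y| <= B) ->
  forall y : R, `|y| <= r ->
    `|g 0%N y - (taylor_poly g n).[y]| <= B * `|y| ^+ n / n`!%:R.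
Proof.
elim: n g => [|n IHn] g dg gB y yr.
  rewrite /taylor_poly big_ord0 horner0 subr0 expr0 fact0 mulr1 divr1.
  exact: gB.
have -> : B * `|y| ^+ n.+1 / n.+1`!%:R =
    B / n`!%:R * `|y| ^+ n.+1 / n.+1%:R by rewrite factS natrM invfM; ring.
pose F := g 0%N - horner (taylor_poly g n.+1).
pose dF y := g 1%N y - (taylor_poly (fun k => g k.+1) n).[y].
rewrite -[_ - _]/(F y).
apply: (@norm_le_monomial_of_derive _ F dF r) => //.
- move=> x xr; have dg0 := dg 0%N x isT xr; rewrite /F /dF -deriv_taylor_poly.
  exact: is_deriveB.
- move=> x xr; rewrite mulrAC; apply: IHn => // k z kn; exact: dg.
- by rewrite /F !fctE horner0_taylor_poly subrr.
Qed.

Lemma exprn_le_fact_expR (R : realType) (x : R) (n : nat) :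
  0 <= x -> x ^+ n <= n`!%:R * expR x.
Proof.
move=> x0; case: n => [|n].
  by rewrite expr0 fact0 mul1r (le_trans _ (expR_ge1Dx x))// lerDl.
rewrite -ler_pdivrMl ?ltr0n ?fact_gt0// mulrC.
by rewrite (le_trans _ (expR_ge1Dxn n x0))// lerDr.
Qed.

(** The [n]-th derivative has modulus [lam ^+ n * expR (- (lam * (c + y)))], which is largest at
    [y = -1/2]; hence [c - 2^-1] in the hypothesis. The centre [c] is [3/2] for a dyadic panel and
    [1/2] for the interval at the origin. *)
Lemma expR_poly_approx (R : realType) (lam c : R) (n : nat) : 0 <= lam ->
  lam ^+ n * expR (- (lam * (c - 2^-1))) <= n`!%:R ->
  exists2 p : {poly R}, (size p <= n)%N &
    forall y : R, `|y| <= 2^-1 ->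
      `|expR (- (lam * (c + y))) - p.[y]| <= 2^-1 ^+ n.
Proof.
move=> lam0 lamn.
(* Writing the exponent as a polynomial lets the derivative of the composite be inferred. *)
pose P : {poly R} := (- lam) *: 'X - (lam * c)%:P.
have PE y : P.[y] = - (lam * (c + y)).
  by rewrite /P !hornerE; ring.
have dP y : P^`().[y] = - lam.
  by rewrite /P derivB derivZ derivX derivC !hornerE; ring.
pose g k (y : R) := (- lam) ^+ k * expR (P.[y]).
exists (taylor_poly g n) => [|y y2]; first exact: size_taylor_poly.
have -> : expR (- (lam * (c + y))) = g 0%N y by rewrite /g expr0 mul1r PE.
apply: (@le_trans _ _ (n`!%:R * `|y| ^+ n / n`!%:R)); last first.
  rewrite mulrAC mulfV ?mul1r ?pnatr_eq0 -?lt0n ?fact_gt0//.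
  by rewrite lerXn2r// nnegrE invr_ge0.
apply: (taylor_bound (r := 2^-1)) => // [k z _ _|z z2].
  have -> : g k = ((- lam) ^+ k) *: (expR \o horner P) by [].
  apply: is_derive_eq.
  by rewrite dP /g exprS /GRing.scale/=; ring.
rewrite /g PE normrM normrX normrN (ger0_norm lam0) ger0_norm ?expR_ge0//.
rewrite (le_trans _ lamn)// ler_wpM2l ?exprn_ge0// ler_expR lerN2 ler_wpM2l//.
by move: z2; rewrite ler_norml; lra.
Qed.

Lemma normr_falling_le_fact (R : realType) (alpha : R) (n : nat) :
  0 <= alpha <= 1 -> `|\prod_(i < n) (alpha - i%:R)| <= n`!%:R.
Proof.
move=> /andP[a0 a1]; elim: n => [|n IHn].
  by rewrite big_ord0 normr1 fact0.
rewrite big_ord_recr/= normrM factS mulnC natrM ler_pM//.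
rewrite ler_norml; have : 0 <= n%:R :> R by []. 
by rewrite -natr1; lra.
Qed.

Lemma powR_poly_approx (R : realType) (alpha : R) (n : nat) :
  0 <= alpha <= 1 ->
  exists2 p : {poly R}, (size p <= n)%N &
    forall y : R, `|y| <= 2^-1 ->
      `|(3 / 2 + y) `^ alpha - p.[y]| <= 2 * 2^-1 ^+ n.
Proof.
move=> alpha01; have /andP[a0 a1] := alpha01.
pose P : {poly R} := 'X + (3 / 2)%:P.
have PE y : P.[y] = 3 / 2 + y by rewrite /P !hornerE addrC.
have dP y : P^`().[y] = 1 by rewrite /P derivD derivX derivC !hornerE; ring.
pose g k (y : R) := (\prod_(i < k) (alpha - i%:R)) * P.[y] `^ (alpha - k%:R).
have P12 y : `|y| <= 2^-1 -> 1 <= P.[y] <= 2.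
  by rewrite ler_norml PE; lra.
exists (taylor_poly g n) => [|y y2]; first exact: size_taylor_poly.
have -> : (3 / 2 + y) `^ alpha = g 0%N y.
  by rewrite /g big_ord0 mul1r PE subr0.
apply: (@le_trans _ _ ((n`!%:R * 2) * `|y| ^+ n / n`!%:R)); last first.
  have -> : n`!%:R * 2 * `|y| ^+ n / n`!%:R = 2 * `|y| ^+ n :> R.
    by field; rewrite pnatr_eq0 -lt0n fact_gt0.
  by rewrite ler_pM2l// lerXn2r// nnegrE invr_ge0.
apply: (taylor_bound (r := 2^-1)) => //
    [k z _ /P12/andP[z1 z2]|z /P12/andP[z1 z2]].
  have Pz0 : 0 < P.[z] by exact: lt_le_trans z1.
  have dpow := @is_derive1_powR R (alpha - k%:R) _ Pz0.
  have -> : g k = (\prod_(i < k) (alpha - i%:R)) *: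
    ((fun x : R => x `^ (alpha - k%:R)) \o horner P) by [].
  apply: is_derive_eq.
  rewrite dP /g big_ord_recr/= /GRing.scale/=.
  by rewrite -natr1 opprD addrA; ring.
rewrite /g normrM ler_pM// ?normr_falling_le_fact//.
rewrite ger0_norm ?powR_ge0//.
(* The base lies in [[1, 2]] and the exponent [alpha - n] is at most 1, so the power is at most 2
   for every [n], including [n = 0]. *)
apply: (@le_trans _ _ (P.[z] `^ 1)); last by rewrite powRr1// (le_trans _ z1).
by rewrite ler_powR// lerBlDr (le_trans a1)// lerDl.
Qed.

(** Each factor has an approximant of size at most [n], so their product stays within the degree
    that an [n]-point rule integrates exactly. *)
Lemma expR_powR_poly_approx (R : realType) (alpha a t : R) (n : nat) :
  0 <= alpha <= 1 -> 0 < a -> 0 <= t ->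
  exists2 p : {poly R}, (size p <= 2 * n)%N &
    forall s : R, a <= s <= 2 * a ->
      `|expR (- (s * t)) * s `^ alpha - p.[s]| <= 6 * a `^ alpha * 2^-1 ^+ n.
Proof.
move=> alpha01 a0 t0; have at0 : 0 <= a * t by rewrite mulr_ge0// ltW.
have [p sp pP] : exists2 p : {poly R}, (size p <= n)%N &
    forall y : R, `|y| <= 2^-1 ->
      `|expR (- (a * t * (3 / 2 + y))) - p.[y]| <= 2^-1 ^+ n.
  apply: expR_poly_approx => //.
  have -> : 3 / 2 - 2^-1 = 1 :> R by field.
  by rewrite mulr1 expRN ler_pdivrMr ?expR_gt0// exprn_le_fact_expR.
have [q sq qP] := powR_poly_approx n alpha01.
(* [X] maps the panel [[a, 2a]] onto [[-1/2, 1/2]]. *)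
pose X : {poly R} := a^-1 *: 'X - (3 / 2)%:P.
exists (a `^ alpha *: ((p * q) \Po X)).
  have sX : (size X <= 2)%N.
    rewrite (leq_trans (size_polyD _ _))// geq_max size_polyN.
    rewrite (leq_trans (size_scale_leq _ _)) ?size_polyX//.
    by rewrite (leq_trans (size_polyC_leq1 _)).
  rewrite (leq_trans (size_scale_leq _ _))//.
  have [->|pq0] := eqVneq (p * q) 0; first by rewrite comp_poly0 size_poly0.
  rewrite (leq_trans (size_comp_poly_leq _ _))//.
  have := size_polyMleq p q; move: pq0; rewrite -size_poly_gt0.
  move: (size (p * q)) (size X) sX sp sq => [//|m] u; nia.
move=> s /andP[as_ sa].
have [y y2 ->] : exists2 y, `|y| <= 2^-1 & s = a * (3 / 2 + y).
  exists (s / a - 3 / 2); last by field; rewrite gt_eqF.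
  rewrite ler_norml lerBrDr lerBlDr ler_pdivlMr// ler_pdivrMr//.
  by apply/andP; split; lra.
have y32 : 1 <= 3 / 2 + y <= 2 by move: y2; rewrite ler_norml; lra.
have y0 : 0 <= 3 / 2 + y by lra.
rewrite hornerZ horner_comp hornerM.
have -> : X.[a * (3 / 2 + y)] = y.
  by rewrite /X hornerD hornerN hornerC hornerZ hornerX mulKf ?gt_eqF// addrAC
       subrr add0r.
rewrite powRM ?(ltW a0)// [a * _ * t]mulrAC.
have := pP _ y2; have := qP _ y2.
set E := expR _; set U := _ `^ alpha; set h := _ ^+ n => hq hp.
have -> : E * (a `^ alpha * U) - a `^ alpha * (p.[y] * q.[y]) =
  a `^ alpha * ((E - p.[y]) * U + p.[y] * (U - q.[y])) by ring.
rewrite normrM (ger0_norm (powR_ge0 _ _)) [6 * _]mulrC -mulrA.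
rewrite ler_wpM2l ?powR_ge0//.
have E1 : `|E| <= 1.
  by rewrite ger0_norm ?expR_ge0// -expR0 ler_expR oppr_le0 mulr_ge0.
have U2 : `|U| <= 2.
  case/andP: alpha01 => _ al1.
  rewrite ger0_norm ?powR_ge0// (le_trans (ler1_powR _ al1))//; lra.
have h1 : h <= 1 by apply: exprn_ile1; rewrite ?invr_ge0// invf_le1// ler1n.
have p2 : `|p.[y]| <= 2.
  have -> : p.[y] = E - (E - p.[y]) by ring.
  by rewrite (le_trans (ler_normB _ _))//; lra.
(* The first summand bounds [(E - p) * U] using [|U| <= 2], the second [p * (U - q)] using
   [|p| <= 2]. *)
have -> : 6 * h = h * 2 + 2 * (2 * h) by ring.
by rewrite (le_trans (ler_normD _ _))// !normrM lerD// ler_pM.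
Qed.

(** * Gauss rules *)

Lemma finite_set_root (R : realType) (p : {poly R}) : p != 0 ->
  finite_set [set x | root p x].
Proof.
move=> p0; apply: contrapT => /(@infinite_set_fset _ _ (size p))[B Bp].
rewrite leqNgt => /negP; apply; apply: max_poly_roots => //.
- by apply/allP => x xB; exact: Bp.
- exact: finmap.fset_uniq.
Qed.

Lemma lebesgue_itv_lty (R : realType) (a b : R) : (mu R `[a, b] < +oo)%E.
Proof. by rewrite lebesgue_measure_itv/=; case: ifP; rewrite ltry. Qed.

Lemma integrable_itv_bounded (R : realType) (a b K : R) (f : R -> R) :
  measurable_fun `[a, b] f -> (forall x, a <= x <= b -> `|f x| <= K) ->
  (mu R).-integrable `[a, b] (EFin \o f).
Proof.
move=> mf fK; apply: measurable_bounded_integrable => //.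
- exact: lebesgue_itv_lty.
- exists K; split; first exact: num_real.
  by move=> r Kr x /=; rewrite in_itv/= => /fK/le_trans; apply; exact: ltW.
Qed.

Lemma horner_bounded_itv (R : realType) (a b : R) (p : {poly R}) :
  exists2 K, 0 <= K & forall x, a <= x <= b -> `|p.[x]| <= K.
Proof.
exists (\sum_(i < size p) `|p`_i| * (`|a| + `|b|) ^+ i).
  by apply: sumr_ge0 => i _; rewrite mulr_ge0// exprn_ge0// addr_ge0.
move=> x /andP[ax xb]; rewrite horner_coef (le_trans (ler_norm_sum _ _ _))//.
apply: ler_sum => i _; rewrite normrM normrX ler_wpM2l// lerXn2r ?nnegrE//.
have := ler_norm b; have := ler_norm (- a); rewrite normrN.
have := normr_ge0 a; have := normr_ge0 b.
by rewrite ler_norml => *; apply/andP; split; lra.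
Qed.

Section gauss_rule.
Context {R : realType} (wt : R -> R) (a b : R) (n : nat) (s w : 'I_n -> R).
(* Positivity is not required at [a], where the Jacobi weight vanishes. *)
Hypotheses (ab : a < b) (mwt : measurable_fun `[a, b] wt)
  (wt0 : forall x, a < x <= b -> 0 < wt x) (wta : 0 <= wt a)
  (wt1 : forall x, a <= x <= b -> wt x <= 1)
  (rule : is_gauss_rule wt a b s w).

Lemma weight_ge0 x : a <= x <= b -> 0 <= wt x.
Proof.
move=> /andP[]; rewrite le_eqVlt => /predU1P[<-//|ax xb].
by apply/ltW/wt0; rewrite ax.
Qed.

Lemma weight_norm_le1 x : a <= x <= b -> `|wt x| <= 1.
Proof. by move=> xab; rewrite ger0_norm ?weight_ge0// wt1. Qed.

Lemma integrable_mul_weight (f : R -> R) K :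
  measurable_fun `[a, b] f -> (forall x, a <= x <= b -> `|f x| <= K) ->
  (mu R).-integrable `[a, b] (EFin \o (fun x => f x * wt x)).
Proof.
move=> mf fK; apply: (@integrable_itv_bounded _ _ _ K).
  exact: measurable_funM.
move=> x xab; rewrite normrM -[K]mulr1 ler_pM//; [exact: fK|].
exact: weight_norm_le1.
Qed.

Lemma integrable_horner_weight (p : {poly R}) :
  (mu R).-integrable `[a, b] (EFin \o (fun x => p.[x] * wt x)).
Proof.
have [K _ pK] := horner_bounded_itv a b p.
by apply: (integrable_mul_weight _ pK); exact: measurable_poly.
Qed.

Lemma gauss_rule_exact (p : {poly R}) : (size p <= 2 * n)%N ->
  \int[mu R]_(x in `[a, b]) (p.[x] * wt x) = \sum_(k < n) w k * p.[s k].
Proof. by move=> /rule; rewrite /Rintegral => ->. Qed.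

(** A zero integral would make the integrand vanish almost everywhere. Then [[a, b]] would be
    covered by a null set, the finitely many roots of [q] and the point [a], although its length is
    positive. *)
Lemma sqr_weight_integral_gt0 (q : {poly R}) : q != 0 ->
  0 < \int[mu R]_(x in `[a, b]) ((q ^+ 2).[x] * wt x).
Proof.
move=> q0; rewrite lt_neqAle Rintegral_ge0 ?andbT; last first.
  move=> x /=; rewrite in_itv/= => xab.
  by rewrite horner_exp mulr_ge0 ?sqr_ge0 ?weight_ge0.
apply/eqP => I0.
have if2 := integrable_horner_weight (q ^+ 2).
have : (\int[mu R]_(x in `[a, b]) `|((q ^+ 2).[x] * wt x)%:E| = 0)%E.
  rewrite (_ : (\int[mu R]_(x in `[a, b]) `|((q ^+ 2).[x] * wt x)%:E| =
     \int[mu R]_(x in `[a, b]) ((q ^+ 2).[x] * wt x)%:E)%E); last first.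
    apply: eq_integral => x; rewrite inE/= in_itv/= => xab; rewrite ger0_norm//.
    by rewrite horner_exp mulr_ge0 ?sqr_ge0 ?weight_ge0.
  by rewrite -[LHS]fineK ?(integrable_fin_num _ if2)//; congr EFin; rewrite I0.
move/(ae_eq_integral_abs (mu R) (measurable_itv _) (measurable_int _ if2)).
case=> A [mA A0 sA].
have fZ : finite_set ([set x | root q x] `|` [set a]).
  by rewrite finite_setU; split; [exact: finite_set_root|exact: finite_set1].
have mZ : measurable ([set x | root q x] `|` [set a]).
  exact/countable_measurable/finite_set_countable.
have : (mu R `[a, b] <= mu R (A `|` ([set x | root q x] `|` [set a])))%E.
  apply: le_measure; rewrite ?inE//; first exact: measurableU.
  move=> x /=; rewrite in_itv/= => xab.
  have [->|xa] := eqVneq x a; first by right; right.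
  have [qx|qx] := boolP (root q x); first by right; left.
  left; apply: sA => /= /(_ _); rewrite in_itv/= => /(_ xab) [] /eqP.
  rewrite mulf_eq0 horner_exp expf_eq0/= -[_ == 0]/(root q x) (negbTE qx)/=.
  by rewrite gt_eqF// wt0// lt_neqAle eq_sym xa.
have -> : mu R (A `|` ([set x | root q x] `|` [set a])) = mu R A.
  apply: measureU0 => //; apply: countable_lebesgue_measure0.
  exact: finite_set_countable.
rewrite A0.
rewrite lebesgue_measure_itv/= lte_fin ab -EFinB lee_fin subr_le0 leNgt.
by rewrite ab.
Qed.

(* [q k ^+ 2] has degree [2n - 2] and vanishes at every node but [s k], so the
   rule integrates it, and its product with any affine polynomial, exactly. *)
Let q k : {poly R} := \prod_(i < n | i != k) ('X - (s i)%:P).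

Let size_q k : size (q k) = n.
Proof.
have -> : q k = \prod_(i <- enum (predC1 k)) ('X - (s i)%:P) by rewrite big_enum.
rewrite size_prod_XsubC -cardE cardC1 card_ord; apply: prednK.
exact: leq_ltn_trans (ltn_ord k).
Qed.

Let q_neq0 k : q k != 0.
Proof. by rewrite -size_poly_gt0 size_q (leq_ltn_trans _ (ltn_ord k)). Qed.

Let size_q2 k : size (q k ^+ 2) = (2 * n).-1.
Proof.
by rewrite expr2 size_mul ?q_neq0// size_q mul2n addnn.
Qed.

Let sum_q2 k (p : {poly R}) :
  \sum_(i < n) w i * (p * q k ^+ 2).[s i] = w k * (q k).[s k] ^+ 2 * p.[s k].
Proof.
rewrite (bigD1 k)//= big1 ?addr0 => [|i ik].
  by rewrite hornerM horner_exp mulrCA mulrC.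
rewrite hornerM horner_exp (_ : (q k).[s i] = 0) ?expr0n ?mulr0//.
by rewrite /q (bigD1 i)//= hornerM !hornerE subrr mul0r.
Qed.

(** On [q k ^+ 2] the quadrature sum reduces to its term at [s k], and exactness equates that term
    with a positive integral. *)
Let wq_gt0 k : 0 < w k * (q k).[s k] ^+ 2.
Proof.
have := sqr_weight_integral_gt0 (q_neq0 k).
rewrite gauss_rule_exact; last by rewrite size_q2 leq_pred.
by have := sum_q2 k 1; rewrite mul1r hornerC mulr1 => ->.
Qed.

Lemma gauss_weight_ge0 k : 0 <= w k.
Proof.
have := wq_gt0 k; rewrite leNgt; apply: contraTN => wk; rewrite -leNgt.
by rewrite nmulr_rle0// sqr_ge0.
Qed.

(** For an affine [p] nonnegative on the interval, the integral of [p * q k ^+ 2] is nonnegative and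
    equals a positive multiple of [p.[s k]]. Taking [p] to be ['X - a] and [b - 'X] locates the
    node. *)
Lemma gauss_node_itv k : a <= s k <= b.
Proof.
have sgn (p : {poly R}) : (size p <= 2)%N ->
    (forall x, a <= x <= b -> 0 <= p.[x]) -> 0 <= p.[s k].
  move=> sp p0; rewrite -(pmulr_rge0 _ (wq_gt0 k)) -sum_q2 -gauss_rule_exact.
    apply: Rintegral_ge0 => x /=; rewrite in_itv/= => xab.
    by rewrite hornerM horner_exp mulr_ge0 ?weight_ge0// mulr_ge0 ?sqr_ge0 ?p0.
  apply: (leq_trans (size_polyMleq _ _)); rewrite size_q2.
  by move: sp (ltn_ord k); lia.
apply/andP; split.
  have := sgn ('X - a%:P); rewrite size_XsubC hornerXsubC subr_ge0; apply=> // x.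
  by rewrite hornerXsubC subr_ge0 => /andP[].
have := sgn (- ('X - b%:P)).
rewrite size_polyN size_XsubC hornerN hornerXsubC oppr_ge0 subr_le0; apply=> // x.
by rewrite hornerN hornerXsubC oppr_ge0 subr_le0 => /andP[].
Qed.

(** Exactness on [p] replaces [f] by [f - p] in both the integral and the sum. Each is then at most
    [e] times the mass [W] of the weight, and [W <= b - a] because the weight is at most 1. *)
Lemma gauss_rule_error (f : R -> R) (p : {poly R}) (e : R) :
  measurable_fun `[a, b] f -> (size p <= 2 * n)%N -> (0 < n)%N ->
  (forall x, a <= x <= b -> `|f x - p.[x]| <= e) ->
  `|\int[mu R]_(x in `[a, b]) (f x * wt x) - \sum_(k < n) f (s k) * w k|
  <= 2 * e * (b - a).
Proof.
move=> mf sp n0 fp.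
have e0 : 0 <= e by apply: le_trans (fp a _); rewrite ?normr_ge0 ?lexx ?ltW.
have mfp : measurable_fun `[a, b] (fun x => f x - p.[x]).
  by apply: measurable_funB => //; exact: measurable_poly.
have ifp := integrable_mul_weight mfp fp.
have ip := integrable_horner_weight p.
have iwt : (mu R).-integrable `[a, b] (EFin \o wt).
  exact: integrable_itv_bounded weight_norm_le1.
have W1 : \int[mu R]_(x in `[a, b]) wt x <= b - a.
  have -> : b - a = \int[mu R]_(x in `[a, b]) 1.
    transitivity (fine (mu R `[a, b])).
      by rewrite lebesgue_measure_itv/= lte_fin ab.
    by rewrite Rintegral_cst// mul1r.
  apply: le_Rintegral => //.
    apply: (@integrable_itv_bounded _ _ _ 1) => // x _.
    by rewrite normr1.
(* The constant polynomial has size 1, so exactness on it uses [0 < n]. *)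
have sumw : \sum_(k < n) w k = \int[mu R]_(x in `[a, b]) wt x.
  have := @gauss_rule_exact 1; rewrite size_poly1 muln_gt0 n0 => /(_ isT).
  under eq_Rintegral do rewrite hornerC mul1r.
  by under [in RHS]eq_bigr do rewrite hornerC mulr1.
set W := \int[mu R]_(x in `[a, b]) wt x in W1 sumw.
have intE : \int[mu R]_(x in `[a, b]) (f x * wt x) =
    \int[mu R]_(x in `[a, b]) ((f x - p.[x]) * wt x) +
    \sum_(k < n) w k * p.[s k].
  rewrite -gauss_rule_exact// -RintegralD//.
  by apply: eq_Rintegral => x _; rewrite -mulrDl subrK.
have sumE : \sum_(k < n) f (s k) * w k =
    \sum_(k < n) (f (s k) - p.[s k]) * w k + \sum_(k < n) w k * p.[s k].
  rewrite -big_split/=; apply: eq_bigr => k _.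
  by rewrite [w k * _]mulrC -mulrDl subrK.
rewrite intE sumE opprD addrACA subrr addr0 (le_trans (ler_normB _ _))//.
rewrite mulrDl mul1r mulrDl lerD//.
  apply: (@le_trans _ _ (e * W)); last exact: ler_wpM2l.
  apply: (le_trans (le_normr_Rintegral _ ifp)) => //.
  rewrite /W -RintegralZl//; apply: le_Rintegral => //.
  - exact: (integrable_norm ifp).
  - apply: (@integrable_itv_bounded _ _ _ `|e|); first exact: measurable_funM.
    move=> x xab; rewrite normrM -[leRHS]mulr1 ler_pM//.
    exact: weight_norm_le1.
  - move=> x /=; rewrite in_itv/= => xab.
    rewrite normrM [`|wt x|]ger0_norm ?weight_ge0//.
    by rewrite ler_wpM2r ?weight_ge0 ?fp.
apply: (@le_trans _ _ (e * W)); last exact: ler_wpM2l.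
rewrite -sumw mulr_sumr (le_trans (ler_norm_sum _ _ _))//; apply: ler_sum => k _.
rewrite normrM [`|w k|]ger0_norm ?gauss_weight_ge0//.
by rewrite ler_wpM2r ?gauss_weight_ge0 ?fp ?gauss_node_itv.
Qed.

End gauss_rule.

(** * The Laplace integral of a power *)

Lemma measurable_expRM (R : realType) (t : R) (D : set R) :
  measurable_fun D (fun x : R => expR (- (x * t))).
Proof.
apply: measurable_funTS; apply: measurableT_comp => //.
by apply: measurable_funN; apply: measurable_funM.
Qed.

Lemma integral_expRM_itvy (R : realType) (S c : R) : 0 < c ->
  (\int[mu R]_(x in `[S, +oo[) (expR (- (x * c)))%:E =
   (c^-1 * expR (- (S * c)))%:E)%E.
Proof.
move=> c0.
pose P : {poly R} := (- c) *: 'X.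
have PE y : P.[y] = - (y * c) by rewrite /P !hornerE mulNr mulrC.
have dP y : P^`().[y] = - c by rewrite /P derivZ derivX !hornerE; ring.
pose F := (- c^-1) *: (expR \o horner P).
have dF (x : R) : is_derive x 1 F (expR (- (x * c))).
  rewrite /F; apply: is_derive_eq.
  rewrite dP PE /GRing.scale/= mulrN mulrNN mulrCA mulVf ?mulr1// gt_eqF//.
have cF (x : R) : {for x, continuous F}.
  by apply/differentiable_continuous/derivable1_diffP; apply: ex_derive.
rewrite (@ge0_continuous_FTC2y _ _ F _ 0).
- have -> : F S = - c^-1 * expR P.[S] by [].
  by rewrite -EFinB sub0r mulNr opprK PE.
- by move=> x _; exact: expR_ge0.
- have -> : (fun x : R => expR (- (x * c))) = expR \o horner P.
    by apply/funext => x /=; rewrite PE.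
  by apply: derivable_within_continuous => x _; exact: ex_derive.
- rewrite -(scaler0 _ (- c^-1)); apply: cvgZl_tmp.
  have -> : expR \o horner P = (fun y : R => expR (- y)) \o (fun x : R => x * c).
    by apply/funext => x /=; rewrite PE.
  apply: (@cvg_comp _ _ _ _ _ _ (pinfty_nbhs R)); last exact: cvgr_expR.
  by apply: gt0_cvgMly => //; exact: cvg_id.
- by move=> x _; exact: ex_derive.
- by apply: cvg_at_right_filter; exact: cF.
- by move=> x _; rewrite derive1E derive_val.
Qed.

Section laplace.
Context {R : realType} (alpha : R).
Hypotheses (alpha01 : 0 < alpha < 1).

Definition laplace_integrand (t s : R) : R := expR (- (s * t)) * s `^ alpha.

Let f := laplace_integrand.

Lemma laplace_integrand_ge0 t s : 0 <= f t s.
Proof. by rewrite mulr_ge0 ?expR_ge0 ?powR_ge0. Qed.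

Lemma measurable_laplace_integrand t D : measurable_fun D (f t).
Proof.
apply: measurable_funM; first exact: measurable_expRM.
by apply: measurable_funTS; exact: measurable_powR.
Qed.

(** Half of the exponential decay is spent on absorbing the power: [s^alpha <= 1 + s], and
    [s <= (2 / t) * e^(s t / 2)] because [e^x >= x]. *)
Lemma laplace_integrand_le t s : 0 < t -> 0 <= s ->
  f t s <= (1 + 2 / t) * expR (- (s * (t / 2))).
Proof.
move=> t0 s0; rewrite /f /laplace_integrand.
have sa : s `^ alpha <= 1 + s.
  have [s1|s1] := leP s 1.
    rewrite (@le_trans _ _ 1) ?lerDl//.
    have := @ge0_ler_powR R alpha _ s 1; rewrite powR1; apply => //.
      by case/andP: alpha01 => /ltW.
    by rewrite nnegrE.
  rewrite (@le_trans _ _ s) ?lerDr//.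
  by rewrite ler1_powR ?ltW//; case/andP: alpha01.
have -> : - (s * t) = - (s * (t / 2)) + - (s * (t / 2)) by field.
rewrite expRD -mulrA [leRHS]mulrC ler_wpM2l ?expR_ge0//.
rewrite expRN ler_pdivrMl ?expR_gt0//.
have e1 := expR_ge1Dx (s * (t / 2)).
have st0 : 0 <= s * (t / 2) by rewrite mulr_ge0// divr_ge0// ltW.
have -> : expR (s * (t / 2)) * (1 + 2 / t) =
   expR (s * (t / 2)) + expR (s * (t / 2)) * (2 / t) by ring.
rewrite (le_trans sa)// lerD//; first by lra.
rewrite [leLHS](_ : _ = s * (t / 2) * (2 / t)); last by field; rewrite gt_eqF.
by rewrite ler_wpM2r ?divr_ge0 ?ltW//; lra.
Qed.

Lemma integral_laplace_tail_le t S : 0 < t -> 0 <= S ->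
  (\int[mu R]_(x in `[S, +oo[) (f t x)%:E <=
   ((1 + 2 / t) * (2 / t) * expR (- (S * (t / 2))))%:E)%E.
Proof.
move=> t0 S0.
have t20 : 0 < t / 2 by rewrite divr_gt0.
have c0 : 0 <= 1 + 2 / t by rewrite addr_ge0// divr_ge0// ltW.
apply: (@le_trans _ _ (\int[mu R]_(x in `[S, +oo[)
  ((1 + 2 / t)%:E * (expR (- (x * (t / 2))))%:E))%E).
  apply: ge0_le_integral => //.
  - by move=> x _; rewrite lee_fin laplace_integrand_ge0.
  - by apply/measurable_EFinP; exact: measurable_laplace_integrand.
  - apply/measurable_EFinP; apply: measurable_funM => //.
    exact: measurable_expRM.
  - move=> x /=; rewrite in_itv/= andbT => Sx; rewrite -EFinM lee_fin.
    by apply: laplace_integrand_le => //; exact: le_trans Sx.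
rewrite ge0_integralZl//.
- rewrite integral_expRM_itvy// -EFinM lee_fin invf_div.
  by rewrite -[leRHS]mulrA.
- by apply/measurable_EFinP; exact: measurable_expRM.
Qed.

Lemma integrable_laplace t S : 0 < t -> 0 <= S ->
  (mu R).-integrable `[S, +oo[ (EFin \o f t).
Proof.
move=> t0 S0; apply/integrableP; split.
  by apply/measurable_EFinP; exact: measurable_laplace_integrand.
under eq_integral => x _.
  rewrite /= ger0_norm ?laplace_integrand_ge0//.
  over.
by rewrite (le_lt_trans (integral_laplace_tail_le t0 S0))// ltry.
Qed.

Lemma Rintegral_laplace_tail t S : 0 < t -> 0 <= S ->
  0 <= \int[mu R]_(x in `[S, +oo[) f t x <=
    (1 + 2 / t) * (2 / t) * expR (- (S * (t / 2))).
Proof.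
move=> t0 S0; rewrite Rintegral_ge0/=; last first.
  by move=> x _; exact: laplace_integrand_ge0.
rewrite -lee_fin fineK ?integral_laplace_tail_le//.
exact: integrable_fin_num (integrable_laplace t0 S0).
Qed.

(** A general monotone sequence is allowed because three are needed: one splitting off [[0, 2^M]],
    one for the panels below 1 and one for those above. *)
Lemma Rintegral_laplace_split t (u : nat -> R) m : 0 < t -> 0 <= u 0%N ->
  {homo u : i j / (i <= j)%N >-> i <= j} ->
  \int[mu R]_(x in `[u 0%N, +oo[) f t x =
  \sum_(i < m) \int[mu R]_(x in `[u i, u i.+1]) f t x +
  \int[mu R]_(x in `[u m, +oo[) f t x.
Proof.
move=> t0 u0 hu; elim: m => [|m IHm]; first by rewrite big_ord0 add0r.
rewrite IHm big_ord_recr/= -addrA; congr (_ + _).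
have um0 : 0 <= u m by exact: le_trans (hu _ _ (leq0n m)).
have umm : u m <= u m.+1 by exact: hu.
have im := integrable_laplace t0 um0.
apply/eqP; rewrite addrC -subr_eq; apply/eqP.
have := @Rintegral_itvB R (f t) (BLeft (u m)) (BInfty _ false) (u m.+1) im.
rewrite !bnd_simp => /(_ umm isT) ->.
rewrite Rintegral_itv_obnd_cbnd//.
apply: integrableS im => //; apply: subset_itvr; rewrite bnd_simp//.
Qed.

Lemma Gamma_div_powR t : 0 < t ->
  Gamma_fn (alpha + 1) / t `^ (alpha + 1) =
  \int[mu R]_(x in `[0, +oo[) f t x.
Proof.
move=> t0; have [a0 a1] := andP alpha01.
have a10 : 0 < alpha + 1 by rewrite addr_gt0.
rewrite /Gamma_fn addrK.
pose P : {poly R} := t *: 'X.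
have PE y : P.[y] = y * t by rewrite /P !hornerE mulrC.
have dP y : (horner P)^`()%classic y = t.
  by rewrite derive1E derive_val /P derivZ derivX !hornerE.
have dPE : (horner P)^`()%classic = cst t by apply/funext => y; rewrite dP.
pose G (x : R) := x `^ alpha * expR (- x).
have := @increasing_ge0_integration_by_substitutiony R (horner P) G 0.
rewrite PE mul0r => ->.
- rewrite (_ : (\int[mu R]_(x in `[0%R, +oo[) _ =
    \int[mu R]_(x in `[0%R, +oo[) ((t `^ (alpha + 1))%:E * (f t x)%:E))%E).
    rewrite integralZl//; last exact: integrable_laplace.
    rewrite fineM//; last exact: integrable_fin_num (integrable_laplace t0 _).
    rewrite mulrC mulKf//= gt_eqF// powR_gt0//.
  apply: eq_integral => x; rewrite inE/= in_itv/= andbT => x0.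
  rewrite -EFinM; congr EFin; rewrite !fctE dP /G /f /laplace_integrand PE.
  rewrite powRM// ?(ltW t0)// powRD ?(gt_eqF t0) ?implybT// powRr1 ?(ltW t0)//.
  ring.
- by move=> x y _ _ xy; rewrite !PE ltr_pM2r.
- by rewrite dPE => x _; exact: cst_continuous.
- by rewrite dPE; exact: is_cvg_cst.
- by rewrite dPE; exact: is_cvg_cst.
- split; first by move=> x _; exact: derivable_horner.
  by apply: cvg_at_right_filter; exact: continuous_horner.
- have -> : horner P = (fun x : R => x * t) by apply/funext => x; rewrite PE.
  by apply: gt0_cvgMly => //; exact: cvg_id.
- have cexp (x : R) : expR (- y) @[y --> x] --> expR (- x).
    by apply: (@continuous_comp _ _ _ -%R expR);
      [exact: opp_continuous|exact: continuous_expR].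
  apply/continuous_within_itvcyP; split.
    move=> x; rewrite in_itv/= andbT => x0; apply: cvgM; last exact: cexp.
    apply: (differentiable_continuous (f := fun y : R => y `^ alpha)).
    apply/derivable1_diffP; apply: derivable_powR.
    by rewrite in_itv/= x0.
  (* Continuity at the closed end: since [alpha > 0], the value of the power at 0 is 0, which is
     also its limit from the right. *)
  have -> : G 0 = 0 * expR (- 0) by rewrite /G powR0// gt_eqF.
  apply: cvgM; first exact: powR_cvg0.
  exact/cvg_at_right_filter/cexp.
- by move=> x _; rewrite mulr_ge0 ?expR_ge0 ?powR_ge0.
Qed.
End laplace.

(** * Error of the composite rule *)

Lemma gauss_legendre_laplace_error (R : realType) (alpha a b t : R) (n : nat)
    (s w : 'I_n -> R) : 0 < alpha < 1 -> 0 < a -> b = 2 * a -> 0 <= t ->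
  (0 < n)%N -> is_gauss_rule (fun=> 1) a b s w ->
  `|\int[mu R]_(x in `[a, b]) laplace_integrand alpha t x -
    \sum_(k < n) expR (- (s k * t)) * s k `^ alpha * w k|
  <= 12 * (a * a `^ alpha) * 2^-1 ^+ n.
Proof.
move=> /andP[al0 al1] a0 -> t0 n0 rule.
have alpha01 : 0 <= alpha <= 1 by rewrite !ltW.
have [p sp pP] := expR_powR_poly_approx n alpha01 a0 t0.
have := @gauss_rule_error R (fun=> 1) a (2 * a) n s w.
move=> /(_ _ _ _ _ _ rule (laplace_integrand alpha t) p _ _ sp n0 pP).
under eq_Rintegral do rewrite mulr1.
have -> : 2 * (6 * a `^ alpha * 2^-1 ^+ n) * (2 * a - a) =
  12 * (a * a `^ alpha) * 2^-1 ^+ n by ring.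
apply => //; first by lra.
exact: measurable_laplace_integrand.
Qed.

(** The power belongs to the weight, so only the exponential is approximated, around [a / 2]. With
    [a * t <= 1] its derivatives in the rescaled variable are bounded by 1, hence by [n!]. *)
Lemma gauss_jacobi_laplace_error (R : realType) (alpha a t : R) (n : nat)
    (s w : 'I_n -> R) : 0 < alpha < 1 -> 0 < a <= 1 -> 0 <= t -> a * t <= 1 ->
  (0 < n)%N -> is_gauss_rule (fun x => x `^ alpha) 0 a s w ->
  `|\int[mu R]_(x in `[0, a]) laplace_integrand alpha t x -
    \sum_(k < n) expR (- (s k * t)) * w k| <= 2 * 2^-1 ^+ n.
Proof.
move=> /andP[al0 al1] /andP[a0 a1] t0 at1 n0 rule.
have at0 : 0 <= a * t by rewrite mulr_ge0// ltW.
have [p sp pP] : exists2 p : {poly R}, (size p <= n)%N &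
    forall y : R, `|y| <= 2^-1 ->
      `|expR (- (a * t * (2^-1 + y))) - p.[y]| <= 2^-1 ^+ n.
  apply: expR_poly_approx => //.
  rewrite subrr mulr0 oppr0 expR0 mulr1 (@le_trans _ _ 1) ?exprn_ile1//.
  by rewrite ler1n fact_gt0.
pose X : {poly R} := a^-1 *: 'X - (2^-1)%:P.
have sX : (size X <= 2)%N.
  rewrite (leq_trans (size_polyD _ _))// geq_max size_polyN.
  rewrite (leq_trans (size_scale_leq _ _)) ?size_polyX//.
  by rewrite (leq_trans (size_polyC_leq1 _)).
have spX : (size (p \Po X) <= 2 * n)%N.
  rewrite (leq_trans (size_comp_poly_leq _ _))//.
  by move: (size p) (size X) sX sp => u v; nia.
have pXP (x : R) : 0 <= x <= a ->
    `|expR (- (x * t)) - (p \Po X).[x]| <= 2^-1 ^+ n.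
  move=> /andP[x0 xa].
  rewrite horner_comp /X hornerD hornerN hornerC hornerZ hornerX.
  have -> : x * t = a * t * (2^-1 + (a^-1 * x - 2^-1)).
    by field; rewrite gt_eqF.
  apply: pP; rewrite ler_norml lerBrDr lerBlDr.
  rewrite [a^-1 * x]mulrC ler_pdivlMr// ler_pdivrMr//.
  by apply/andP; split; lra.
have := @gauss_rule_error R (fun x => x `^ alpha) 0 a n s w a0.
move=> /(_ _ _ _ _ rule (fun x => expR (- (x * t))) (p \Po X) _ _ spX n0 pXP).
rewrite subr0 => E; apply: (le_trans (E _ _ _ _ _)).
- by apply: measurable_funTS; exact: measurable_powR.
- by move=> x /andP[x0 _]; exact: powR_gt0.
- exact: powR_ge0.
- move=> x /andP[x0 xa].
  have := @ge0_ler_powR R alpha (ltW al0) x 1; rewrite powR1; apply => //.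
    by rewrite nnegrE.
  exact: le_trans a1.
- exact: measurable_expRM.
by rewrite ler_piMr// mulr_ge0// exprn_ge0// invr_ge0.
Qed.

(** The exponent is the integer part of the binary logarithm of [x], plus one. All the parameters
    are chosen through this lemma. *)
Lemma pow2_ge (R : realType) (x : R) : 1 <= x ->
  exists2 k : nat, x <= 2 ^+ k & k%:R <= (ln 2)^-1 * ln x + 1.
Proof.
move=> x1; have x0 : 0 < x by exact: lt_le_trans x1.
have l20 : 0 < ln 2 :> R by rewrite ln_gt0// ltr1n.
have y0 : 0 <= (ln 2)^-1 * ln x by rewrite mulr_ge0 ?ln_ge0// invr_ge0 ltW.
have /andP[k1 k2] := truncn_itv y0.
exists (Num.truncn ((ln 2)^-1 * ln x)).+1; last by rewrite -natr1 lerD2r.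
rewrite -ler_ln ?posrE ?exprn_gt0// lnXn// -[leRHS]mulr_natr.
by rewrite -ler_pdivrMl// ltW.
Qed.

Lemma sum_geometric2 (R : realType) (c : R) (m : nat) :
  \sum_(i < m) c * 2 ^+ i = c * 2 ^+ m - c.
Proof.
elim: m => [|m IHm]; first by rewrite big_ord0 expr0; ring.
by rewrite big_ord_recr/= IHm exprS; ring.
Qed.

Lemma sum_geometric4 (R : realType) (m : nat) :
  \sum_(i < m) 4 ^+ i = (4 ^+ m - 1) / 3 :> R.
Proof.
elim: m => [|m IHm]; first by rewrite big_ord0 expr0; ring.
by rewrite big_ord_recr/= IHm exprS; field.
Qed.

Lemma dyadic_quadrature_error (R : realType) (alpha t : R)
    (n_o n_s n_l N k : nat) (s_o w_o : 'I_n_o -> R)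
    (s_s w_s : int -> 'I_n_s -> R) (s_l w_l : nat -> 'I_n_l -> R)
    (M := Negz k) :
  0 < alpha < 1 -> 0 < t -> t <= 2 ^+ k ->
  (0 < n_o)%N -> (0 < n_s)%N -> (0 < n_l)%N ->
  is_gauss_rule (fun s => s `^ alpha) 0 (2 ^ M) s_o w_o ->
  (forall j : int, M <= j <= -1 ->
     is_gauss_rule (fun=> 1) (2 ^ j) (2 ^ (j + 1)) (s_s j) (w_s j)) ->
  (forall j : nat, (j <= N)%N ->
     is_gauss_rule (fun=> 1) (2 ^+ j) (2 ^+ j.+1) (s_l j) (w_l j)) ->
  `| Gamma_fn (alpha + 1) / t `^ (alpha + 1)
     - (\sum_(k < n_o) expR (- (s_o k * t)) * w_o k
        + \sum_(i < `|M|%N) \sum_(k < n_s)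
            (let j := M + i%:Z in
             expR (- (s_s j k * t)) * s_s j k `^ alpha * w_s j k)
        + \sum_(j < N.+1) \sum_(k < n_l)
            expR (- (s_l j k * t)) * s_l j k `^ alpha * w_l j k) |
  <= 2 * 2^-1 ^+ n_o + 12 * 2^-1 ^+ n_s + 4 * 4 ^+ N.+1 * 2^-1 ^+ n_l
     + (1 + 2 / t) * (2 / t) * expR (- (2 ^+ N.+1 * (t / 2))).
Proof.
move=> alpha01 t0 tk n_o0 n_s0 n_l0 rule_o rule_s rule_l.
have [al0 al1] := andP alpha01.
have h0 n : 0 <= 2^-1 ^+ n :> R by rewrite exprn_ge0// invr_ge0.
have twoM : 2 ^ M = (2 ^+ k.+1)^-1 :> R by [].
have twoM0 : 0 < 2 ^ M :> R by rewrite twoM invr_gt0 exprn_gt0.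
have twoM1 : 2 ^ M <= 1 :> R.
  by rewrite twoM invf_le1 ?exprn_gt0// exprn_ege1// ler1n.
(* [Negz k] is [-(k + 1)], so the [k + 1] panels of [u] end exactly at 1. *)
pose u (i : nat) : R := 2 ^ (M + i%:Z).
have uE i : u i = 2 ^ M * 2 ^+ i.
  by rewrite /u expfzDr// pnatr_eq0.
have u0 : u 0%N = 2 ^ M by rewrite uE expr0 mulr1.
have um : u k.+1 = 1.
  by rewrite uE twoM mulVf// expf_neq0// pnatr_eq0.
have pow2h (i j : nat) : (i <= j)%N -> 2 ^+ i <= 2 ^+ j :> R.
  by move=> ij; rewrite ler_eXn2l// ltr1n.
have uhomo : {homo u : i j / (i <= j)%N >-> i <= j}.
  by move=> i j ij; rewrite !uE ler_pM2l// pow2h.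
have uS i : u i.+1 = 2 * u i by rewrite !uE exprS; ring.
have ugt0 i : 0 < u i by rewrite uE mulr_gt0// exprn_gt0.
pose v (j : nat) : R := 2 ^+ j.
(* One splitting step along [o] detaches the interval [[0, 2^M]] of the Jacobi rule. *)
pose o (i : nat) : R := if i is 0%N then 0 else 2 ^ M.
have ohomo : {homo o : i j / (i <= j)%N >-> i <= j}.
  by case=> [|i] [|j]//= _; exact: ltW.
have := @Rintegral_laplace_split R alpha alpha01 t o 1 t0 (lexx 0) ohomo.
rewrite -Gamma_div_powR// big_ord1/= => ->.
rewrite -u0.
rewrite (@Rintegral_laplace_split R alpha alpha01 t u k.+1 t0 (ltW (ugt0 _)))//.
have v0 : 0 <= v 0%N by rewrite /v expr0.
rewrite um -[1]/(v 0%N).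
rewrite (@Rintegral_laplace_split R alpha alpha01 t v N.+1 t0 v0 pow2h).
have [] := andP (@Rintegral_laplace_tail R alpha alpha01 t (v N.+1) t0 _).
  by rewrite /v exprn_ge0.
set tail := \int[mu R]_(x in `[v N.+1, +oo[) _ => tail0 tailE.
set Io := Rintegral _ _ _; set Is := \sum_(i < k.+1) _; set Il := \sum_(j < N.+1) _.
set So := \sum_(i < n_o) _; set Ss := \sum_(i < `|M|%N) _.
set Sl := (X in _ - (_ + X)).
have Eo : `|Io - So| <= 2 * 2^-1 ^+ n_o.
  apply: gauss_jacobi_laplace_error => //; rewrite ?u0 ?twoM0//; first exact: ltW.
  rewrite twoM mulrC ler_pdivrMr ?exprn_gt0// mul1r (le_trans tk)// pow2h//.
have Es : `|Is - Ss| <= 12 * 2^-1 ^+ n_s.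
  rewrite /Is /Ss /= -sumrB (le_trans (ler_norm_sum _ _ _))//.
  (* Below 1 the factor [a^alpha] is at most 1, so each panel costs in proportion to its length; the
     lengths add up to [1 - 2^M], whatever [k] is. *)
  apply: (@le_trans _ _ (\sum_(i < k.+1) 12 * 2^-1 ^+ n_s * (2 ^ M * 2 ^+ i))).
    apply: ler_sum => i _.
    apply: (le_trans (gauss_legendre_laplace_error (a := u i) _ _ _ _ _ _)) => //.
    - exact: ltW.
    - have := rule_s (M + i%:Z); rewrite -addrA.
      rewrite (_ : i%:Z + 1 = i.+1%:Z); last by rewrite intS addrC.
      apply; rewrite /M; have := ltn_ord i; lia.
    - have ui1 : u i <= 1 by rewrite -um uhomo// ltnW.
      rewrite -uE [leLHS]mulrAC ler_wpM2l ?mulr_ge0 ?h0// ler_piMr ?(ltW (ugt0 _))//.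
      have := @ge0_ler_powR R alpha (ltW al0) (u i) 1; rewrite powR1; apply => //.
      by rewrite nnegrE ltW.
  rewrite -mulr_sumr -[leRHS]mulr1 ler_wpM2l ?mulr_ge0 ?h0//.
  by rewrite sum_geometric2 -uE um lerBlDr lerDl ltW.
have El : `|Il - Sl| <= 4 * 4 ^+ N.+1 * 2^-1 ^+ n_l.
  rewrite /Il /Sl -sumrB (le_trans (ler_norm_sum _ _ _))//.
  (* Above 1 one has [a^alpha <= a], so the panel starting at [2^i] costs a multiple of [4^i]. *)
  apply: (@le_trans _ _ (\sum_(i < N.+1) 12 * 2^-1 ^+ n_l * 4 ^+ i)).
    apply: ler_sum => i _.
    apply: (le_trans (gauss_legendre_laplace_error (a := v i) _ _ _ _ _ _)) => //.
    - by rewrite /v exprn_gt0.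
    - by rewrite /v exprS.
    - exact: ltW.
    - by apply: rule_l; rewrite -ltnS.
    - rewrite mulrAC ler_wpM2l ?mulr_ge0 ?h0//.
      have -> : 4 ^+ i = v i * v i by rewrite /v -exprMn -natrM.
      have v1 : 1 <= v i by rewrite /v exprn_ege1// ler1n.
      by rewrite ler_wpM2l ?exprn_ge0// ler1_powR// ltW.
  rewrite -mulr_sumr sum_geometric4.
  have -> : 12 * 2^-1 ^+ n_l * ((4 ^+ N.+1 - 1) / 3) =
    4 * 4 ^+ N.+1 * 2^-1 ^+ n_l - 4 * 2^-1 ^+ n_l :> R by field.
  by rewrite lerBlDr lerDl mulr_ge0 ?h0.
have -> : Io + (Is + (Il + tail)) - (So + Ss + Sl) =
  (Io - So) + (Is - Ss) + (Il - Sl) + tail by ring.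
rewrite (le_trans (ler_normD _ _))// lerD ?(ger0_norm tail0)//.
rewrite (le_trans (ler_normD _ _))// lerD//.
by rewrite (le_trans (ler_normD _ _))// lerD.
Qed.

(** The prefactor is at most [6 / delta^2 = 6 e^(2D)], while [S t / 2 >= 5 (1 + L) (1 + D) >= 5 + L
    + 2D]. The exponential thus cancels [e^(2D)] and leaves [e^(-L)] with the factor
    [e^(-5) <= 1/32]. *)
Lemma laplace_tail_small (R : realType) (L D delta t S : R) :
  0 <= L -> 0 <= D -> 0 < delta <= 1 -> delta <= t -> expR D = delta^-1 ->
  10 / delta * (1 + L) * (1 + D) <= S ->
  (1 + 2 / t) * (2 / t) * expR (- (S * (t / 2))) <= 6 / 32 * expR (- L).
Proof.
move=> L0 D0 /andP[d0 d1] dt eD Sge.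
have t0 : 0 < t by exact: lt_le_trans dt.
have tV : t^-1 <= delta^-1 by rewrite lef_pV2.
have dV1 : 1 <= delta^-1 by rewrite invf_ge1.
have tV0 : 0 < t^-1 by rewrite invr_gt0.
have LD0 : 0 <= L * D by rewrite mulr_ge0.
have Y0 : 0 <= 10 / delta * (1 + L) * (1 + D).
  by rewrite mulr_ge0 ?addr_ge0// mulr_ge0 ?addr_ge0// divr_ge0// ltW.
have St : 5 + L + (D + D) <= S * (t / 2).
  apply: (@le_trans _ _ (10 / delta * (1 + L) * (1 + D) * (delta / 2))).
    have -> : 10 / delta * (1 + L) * (1 + D) * (delta / 2) =
      5 * (1 + L + D + L * D) by field; rewrite gt_eqF.
    by lra.
  by apply: ler_pM => //; [rewrite divr_ge0// ltW|rewrite ler_pM2r].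
apply: (@le_trans _ _ (6 * (delta^-1 * delta^-1) * expR (- (5 + L + (D + D))))).
  apply: ler_pM; rewrite ?expR_ge0//.
  - by rewrite mulr_ge0 ?addr_ge0 ?mulr_ge0 ?(ltW tV0).
  - have -> : 6 * (delta^-1 * delta^-1) = (3 * delta^-1) * (2 * delta^-1) by ring.
    apply: ler_pM; rewrite ?addr_ge0 ?mulr_ge0 ?(ltW tV0)//; last by rewrite ler_pM2l.
    by lra.
  - by rewrite ler_expR lerN2.
have expE (c : R) : expR (- (c + L + (D + D))) =
    (expR c)^-1 * (expR L)^-1 * ((expR D)^-1 * (expR D)^-1).
  by rewrite expRN !expRD !invfM.
rewrite expE -eD expRN.
have e5 : 32 <= expR 5 :> R.
  have e1 : 2 <= expR 1 :> R by have := expR_ge1Dx (1 : R).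
  have -> : 32 = 2 ^+ 5 :> R by ring.
  by rewrite -[5]mulr1 expRM_natl lerXn2r// nnegrE ?expR_ge0.
have -> : 6 * (expR D * expR D) *
    ((expR 5)^-1 * (expR L)^-1 * ((expR D)^-1 * (expR D)^-1)) =
    6 * (expR 5)^-1 * (expR L)^-1.
  by field; rewrite !gt_eqF ?expR_gt0.
rewrite ler_wpM2r ?invr_ge0 ?expR_ge0// ler_pM2l// lef_pV2 ?posrE ?expR_gt0//.
Qed.

(** The maximum in [Leps] and the added ones keep the bounds meaningful when [eps >= 1], [delta = 1]
    or [T = 1]. The parameters are fixed before the rules and before [t], so the estimate is uniform
    in [t]. *)
Theorem theorem2p5 (R : realType) (beta : R) (hbeta : 1 < beta < 2) :
  exists C : R, 0 < C /\
  forall delta T eps : R, 0 < delta -> delta <= 1 -> 1 <= T -> 0 < eps ->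
  let Leps := Num.max 0 (ln (1 / eps)) in
  exists (n_o n_s n_l N : nat) (M : int),
    [/\ (0 < n_o)%N, (0 < n_s)%N, (0 < n_l)%N, M < 0 &
      [/\ n_o%:R <= C * (1 + Leps),
          n_s%:R <= C * (1 + Leps),
          n_l%:R <= C * (1 + Leps + ln (1 / delta)),
          N%:R <= C * (1 + ln (1 + Leps) + ln (1 / delta)) &
          (`|M|%N)%:R <= C * (1 + ln T)]] /\
    forall (s_o w_o : 'I_n_o -> R)
           (s_s w_s : int -> 'I_n_s -> R)
           (s_l w_l : nat -> 'I_n_l -> R),
      is_gauss_rule (fun s => s `^ (beta - 1)) 0 (2 ^ M) s_o w_o ->
      (forall j : int, M <= j <= -1 ->
         is_gauss_rule (fun=> 1) (2 ^ j) (2 ^ (j + 1)) (s_s j) (w_s j)) ->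
      (forall j : nat, (j <= N)%N ->
         is_gauss_rule (fun=> 1) (2 ^+ j) (2 ^+ j.+1) (s_l j) (w_l j)) ->
      forall t : R, delta <= t <= T ->
        `| Gamma_fn beta / t `^ beta
           - (\sum_(k < n_o) expR (- (s_o k * t)) * w_o k
              + \sum_(i < `|M|%N) \sum_(k < n_s)
                  (let j := M + i%:Z in
                   expR (- (s_s j k * t)) * s_s j k `^ (beta - 1) * w_s j k)
              + \sum_(j < N.+1) \sum_(k < n_l)
                  expR (- (s_l j k * t)) * s_l j k `^ (beta - 1) * w_l j k) |
        <= eps.
Proof.
have l20 : 0 < ln 2 :> R by rewrite ln_gt0// ltr1n.
have l21 : ln 2 <= 1 :> R.
  by have := @le_ln1Dx R 1; apply; rewrite (lt_trans _ ltr01)// ltrN10.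
have [alpha alpha01 betaE] : exists2 alpha, 0 < alpha < 1 & beta = alpha + 1.
  by exists (beta - 1); [lra|rewrite subrK].
pose K := (ln 2)^-1 : R.
have K1 : 1 <= K by rewrite invf_ge1.
have K0 : 0 < K by exact: lt_le_trans K1.
(* [K] converts natural to binary logarithms. The most demanding count is [n_l = n1 + 2 (N + 1)],
   whose constant part is at most [(7 + 20 + 2) K]. *)
exists (30 * K); split; first by rewrite mulr_gt0.
move=> delta T eps d0 d1 T1 e0 L; set D := ln (1 / delta).
have L0 : 0 <= L by rewrite le_max lexx.
have eL : expR (- L) <= eps.
  rewrite expRN -[leRHS]invrK lef_pV2 ?posrE ?expR_gt0 ?invr_gt0//.
  rewrite -[leLHS]lnK ?posrE ?invr_gt0// ler_expR le_max.
  by rewrite div1r lexx orbT.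
have D0 : 0 <= D by rewrite ln_ge0// div1r invf_ge1.
have eD : expR D = delta^-1 by rewrite lnK ?posrE div1r// invr_gt0.
have eL1 : 1 <= expR L by rewrite -expR0 ler_expR.
have [k1 k1ge k1le] := pow2_ge eL1; rewrite expRK in k1le.
have Y1 : 1 <= 10 / delta * (1 + L) * (1 + D).
  have dV1 : 1 <= delta^-1 by rewrite invf_ge1.
  by rewrite !mulr_ege1//; lra.
have [N Nge Nle] := pow2_ge Y1.
have [k kge kle] := pow2_ge T1.
(* The 6 extra nodes give a factor [1/64] below [e^(-L)]; the [2 (N + 1)] further ones offset the
   growth [4^(N+1)] of the panels above 1. *)
pose n1 := (k1 + 6)%N; pose n_l := (n1 + N.+1.*2)%N.
exists n1, n1, n_l, N, (Negz k).
have lnL0 : 0 <= ln (1 + L) by rewrite ln_ge0// lerDl.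
have lnT0 : 0 <= ln T by rewrite ln_ge0.
have lnLL : ln (1 + L) <= L by rewrite le_ln1Dx// (lt_le_trans _ L0)// ltrN10.
have lnDD : ln (1 + D) <= D by rewrite le_ln1Dx// (lt_le_trans _ D0)// ltrN10.
have KL := mulr_ge0 (ltW K0) L0; have KD := mulr_ge0 (ltW K0) D0.
have Kl := mulr_ge0 (ltW K0) lnL0; have KT := mulr_ge0 (ltW K0) lnT0.
have KlL : K * ln (1 + L) <= K * L by rewrite ler_pM2l.
have n1le : n1%:R <= 7 * (K * (1 + L)).
  by rewrite natrD; move: k1le; rewrite -/K; lra.
have Nle' : N%:R <= 10 * (K * (1 + ln (1 + L) + D)).
  have ln10 : ln 10 <= 9 :> R.
    have -> : 10 = 1 + 9 :> R by ring.
    by rewrite le_ln1Dx// (lt_le_trans _ (ler0n _ 9))// ltrN10.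
  apply: (le_trans Nle); rewrite -/K.
  rewrite !lnM ?posrE ?mulr_gt0 ?invr_gt0 ?ltr_wpDr//.
  rewrite -(div1r delta) -/D.
  have : K * (ln 10 + D + ln (1 + L) + ln (1 + D)) <=
      K * (9 + D + ln (1 + L) + D).
    by rewrite ler_pM2l//; lra.
  by rewrite !mulrDr mulr1; lra.
split.
  split=> //; first by rewrite /n1 addn_gt0 orbT.
  - by rewrite /n1 addn_gt0 orbT.
  - by rewrite /n_l /n1 !addn_gt0 orbT.
  split.
  - by rewrite -mulrA; move: n1le; rewrite !mulrDr; lra.
  - by rewrite -mulrA; move: n1le; rewrite !mulrDr; lra.
  - rewrite /n_l natrD -mul2n natrM -natr1 -mulrA.
    by move: n1le Nle'; rewrite !mulrDr mulr1; lra.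
  - by rewrite -mulrA; move: Nle'; rewrite !mulrDr mulr1; lra.
  - rewrite -mulrA /= -natr1; move: kle; rewrite -/K !mulrDr mulr1; lra.
move=> s_o w_o s_s w_s s_l w_l; rewrite betaE addrK => rule_o rule_s rule_l t.
move=> /andP[dt tT].
have t0 : 0 < t by exact: lt_le_trans dt.
have n10 : (0 < n1)%N by rewrite /n1 addn_gt0 orbT.
have n_l0 : (0 < n_l)%N by rewrite /n_l addn_gt0 n10.
apply: (le_trans (dyadic_quadrature_error alpha01 t0 (le_trans tT kge)
  n10 n10 n_l0 rule_o rule_s rule_l)).
have tail : (1 + 2 / t) * (2 / t) * expR (- (2 ^+ N.+1 * (t / 2))) <=
    6 / 32 * expR (- L).
  apply: (laplace_tail_small L0 D0 _ dt eD); first by rewrite d0.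
  by rewrite (le_trans Nge)// ler_eXn2l// ltr1n.
have h1 : 64 * 2^-1 ^+ n1 <= expR (- L) :> R.
  rewrite /n1 exprD expRN mulrCA (_ : 64 * 2^-1 ^+ 6 = 1); last by field.
  by rewrite mulr1 exprVn lef_pV2 ?posrE ?exprn_gt0 ?expR_gt0.
have -> : 4 * 4 ^+ N.+1 * 2^-1 ^+ n_l = 4 * 2^-1 ^+ n1 :> R.
  rewrite /n_l exprD -mul2n exprM -mulrA; congr (_ * _).
  rewrite mulrCA -exprMn (_ : 4 * 2^-1 ^+ 2 = 1) ?expr1n ?mulr1//; by field.
(* The three quadrature errors total [(2 + 12 + 4) 2^(-n1) <= (18/64) e^(-L)]; with the tail's
   [6/32] this is [(30/64) e^(-L)], below [eps]. *)
by move: h1 tail eL (expR_ge0 (- L)); lra.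
Qed.
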